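(* Let $X$ be a star-Lindelöf regular $P$-space. If $Y$ is an infinite closed and discrete subset of $X$, then $|Y|<\mathrm{cof}(\mathrm{Fin}(w(X))^{\mathbb{N}})$.
   Context: Regular spaces are assumed to be $T_1$. A $P$-space is a space in which every $G_\delta$ set is open. $w(X)$ denotes the weight of $X$. For $A\subseteq X$ and a family $\mathcal{P}$ of subsets of $X$, $St(A,\mathcal{P})=\bigcup\{B\in\mathcal{P} : A\cap B\neq\emptyset\}$. $X$ is star-Lindelöf if for every open cover $\mathcal{U}$ of $X$ there is a countable $\mathcal{V}\subseteq\mathcal{U}$ with $St(\bigcup\mathcal{V},\mathcal{U})=X$. For an infinite set (or cardinal) $\kappa$, $\mathrm{Fin}(\kappa)$ is the set of all finite subsets of $\kappa$, and $\mathrm{Fin}(\kappa)^{\mathbb{N}}$, the set of all functions $f:\mathbb{N}\to\mathrm{Fin}(\kappa)$, is partially ordered by $f\leq g$ iff $f(n)\subseteq g(n)$ for all $n\in\mathbb{N}$. $\mathrm{cof}(\mathrm{Fin}(\kappa)^{\mathbb{N}})$ is the cofinality of $(\mathrm{Fin}(\kappa)^{\mathbb{N}},\leq)$, i.e. the least cardinality of a cofinal subset. *)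

(* Defs.v *)
From mathcomp Require Import all_boot all_order.
From mathcomp Require Import all_classical topology borel_hierarchy.

Set Implicit Arguments.
Unset Strict Implicit.
Unset Printing Implicit Defensive.

Local Open Scope classical_set_scope.
Local Open Scope card_scope.

(* A cardinal is represented by a set of that cardinality; [#<=] compares sets
   living in possibly different types. *)
Definition card_lt (T U : Type) (A : set T) (B : set U) : Prop :=
  (A #<= B) /\ ~ (B #<= A).

Definition has_min_card (T : Type) (P : set (set T)) (A : set T) : Prop :=
  P A /\ forall B, P B -> A #<= B.

(* The least cardinality of a member of [P], represented by a chosen member of
   [P] realizing it; [min_cardP] shows that there is one as soon as [P] is
   nonempty. *)
Definition min_card (T : Type) (P : set (set T)) : set T :=
  xget set0 (has_min_card P).

(* Cardinals are well-founded: take a maximal family [S] of choice functions on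
   [P] that pairwise differ at every member of [P]. Evaluation at any [B] in [P]
   is injective on [S], and by maximality it is onto for some [A] in [P]. *)
Lemma has_min_card_ex (T : Type) (P : set (set T)) :
  P !=set0 -> exists A, has_min_card P A.
Proof.
move=> [A0 PA0].
have [P0|P0] := pselect (P set0).
  by exists set0; split=> // B _; rewrite card_le0x.
have Pne A : P A -> A !=set0.
  by move=> PA; apply/set0P/eqP => A0E; apply: P0; rewrite -A0E.
have [a0 A0a0] := Pne _ PA0.
pose good (S : set (set T -> T)) :=
  (forall s A, S s -> P A -> A (s A)) /\
  (forall s t A, S s -> S t -> P A -> s A = t A -> s = t).
have [|S [[SP Sinj] Smax]] := @Zorn_bigcup _ good.
  move=> F Fgood Ftot; split.
    by move=> s A [S FS Ss] PA; have [SP _] := Fgood _ FS; exact: (SP _ _ Ss PA).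
  move=> s t A [S1 F1 S1s] [S2 F2 S2t] PA.
  have [S12|S21] := Ftot _ _ F1 F2.
  - by have [_ inj] := Fgood _ F2; apply: inj PA => //; exact: S12.
  - by have [_ inj] := Fgood _ F1; apply: inj PA => //; exact: S21.
have [A [PA Aonto]] : exists A, P A /\ forall a, A a -> exists2 s, S s & s A = a.
  apply: contrapT => nA.
  have /choice[t tP] : forall A, exists a,
      P A -> A a /\ forall s, S s -> s A <> a.
    move=> A; have [PA|nPA] := pselect (P A); last by exists a0.
    apply: contrapT => na; apply: nA; exists A; split=> // a Aa.
    apply: contrapT => ns; apply: na; exists a => _; split=> // s Ss sA.
    by apply: ns; exists s.
  have St : ~ S t by move=> St; have [_ /(_ t St)] := tP _ PA0.
  apply: (Smax (S `|` [set t])).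
    by split; [exact: subsetUl | move=> /(_ t (or_intror erefl))/St].
  split=> [s A|s u A].
    by case=> [Ss|->] PA; [exact: (SP _ _ Ss PA) | have [] := tP _ PA].
  move=> [Ss|->] [Su|->] PA //; first exact: (Sinj _ _ _ Ss Su PA).
  - by move=> st; have [_ /(_ s Ss)] := tP _ PA.
  - by move=> tu; have [_ /(_ u Su)] := tP _ PA; rewrite tu.
exists A; split=> // B PB.
apply: (@card_le_trans _ _ _ S).
  apply: card_le_trans (card_image_le (fun s : set T -> T => s A) S).
  by apply: subset_card_le => a /Aonto[s Ss <-]; exists s.
have Binj : {in S &, injective (fun s : set T -> T => s B)}.
  by move=> s t /set_mem Ss /set_mem St; exact: (Sinj _ _ _ Ss St PB).
rewrite -(card_le_eql (inj_card_eq Binj)).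
by apply: subset_card_le => _ [s Ss <-]; exact: (SP _ _ Ss PB).
Qed.

Lemma min_cardP (T : Type) (P : set (set T)) :
  P !=set0 -> has_min_card P (min_card P).
Proof. by move=> /has_min_card_ex[A PA]; exact: (@xgetPex _ set0 _ (ex_intro _ A PA)). Qed.

Definition Fin (T : Type) (K : set T) : set (set T) :=
  [set F | finite_set F /\ F `<=` K].

Definition FinN (T : Type) (K : set T) : set (nat -> set T) :=
  [set f | forall n, Fin K (f n)].

Definition FinN_le (T : Type) (f g : nat -> set T) : Prop :=
  forall n, f n `<=` g n.

Definition cofinal_in (T : Type) (le : T -> T -> Prop) (P D : set T) : Prop :=
  D `<=` P /\ forall p, P p -> exists2 d, D d & le p d.

Definition cof (T : Type) (le : T -> T -> Prop) (P : set T) : set T :=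
  min_card (cofinal_in le P).

Definition cof_FinN (T : Type) (K : set T) : set (nat -> set T) :=
  cof (@FinN_le T) (FinN K).

Lemma cof_FinN_min (T : Type) (K : set T) :
  has_min_card (cofinal_in (@FinN_le T) (FinN K)) (cof_FinN K).
Proof.
by apply: min_cardP; exists (FinN K); split=> // f Kf; exists f => // n.
Qed.

(* [w(X)]. It may be finite for finite [X]; this does not conflict with the
   convention that weights are infinite, since a T1 space with a finite base is
   finite. *)
Definition weight (X : topologicalType) : set (set X) := min_card (@basis X).
Arguments weight : clear implicits.

Lemma weight_min (X : topologicalType) : has_min_card (@basis X) (weight X).
Proof.
apply: min_cardP; exists open; split=> // x A /=.
rewrite nbhsE => -[U [oU Ux] UA].
by exists U.
Qed.

Definition P_space (X : topologicalType) : Prop :=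
  forall A : set X, Gdelta A -> open A.

Definition star (X : Type) (A : set X) (P : set (set X)) : set X :=
  \bigcup_(B in [set B | P B /\ A `&` B !=set0]) B.

Definition open_cover (X : topologicalType) (U : set (set X)) : Prop :=
  U `<=` open /\ \bigcup_(A in U) A = setT.

Definition star_Lindelof (X : topologicalType) : Prop :=
  forall U : set (set X), open_cover U ->
    exists V : set (set X),
      [/\ V `<=` U, countable V & star (\bigcup_(A in V) A) U = setT].

(* [set_type Y] carries the subspace topology. *)
Definition discrete_subset (X : topologicalType) (Y : set X) : Prop :=
  forall Z : set (set_type Y), open Z.

Lemma discrete_subsetP (X : topologicalType) (Y : set X) :
  discrete_subset Y <-> Y `<=` isolated Y.
Proof.
split=> [dY y Yy|iY Z].
  have [U oU UE] := dY [set SigSub (mem_set Yy)].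
  split; first exact: mem_set.
  exists U.
    apply: open_nbhs_nbhs; split=> //.
    by have : (set_val @^-1` U) (SigSub (mem_set Yy)) by rewrite UE.
  apply/seteqP; split=> [x [Ux Yx]|_ ->]; last first.
    split=> //.
    by have : (set_val @^-1` U) (SigSub (mem_set Yy)) by rewrite UE.
  have : (set_val @^-1` U) (SigSub (mem_set Yx)) by [].
  by rewrite UE => /(congr1 set_val).
pose U := \bigcup_(V in [set V : set X | open V /\
  (forall y : set_type Y, V (set_val y) -> Z y)]) V.
exists U; first by apply: bigcup_open => V [].
apply/seteqP; split=> [y [V [_ VZ] /VZ]//|y Zy].
have [_ [V]] := iY _ (set_mem (valP y)).
rewrite nbhsE => -[W [oW Wy] WV] VY.
exists W => //; split=> // z /WV Vz.
have : (V `&` Y) (set_val z) by split=> //; exact: set_mem (valP z).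
by rewrite VY => /val_inj ->.
Qed.

(* Main.v *)
Require Import Defs.
From mathcomp Require Import all_boot all_order.
From mathcomp Require Import all_classical topology borel_hierarchy.

Local Open Scope classical_set_scope.
Local Open Scope card_scope.

(* Choose basic neighbourhoods [O y] whose closures isolate the points of [Y].
   If a cofinal family could be indexed as [g y], [y] in [Y], shrink [O y] to
   [N y] by removing the closures of all sets listed by [g y] that do not have
   [y] in their closure; there are countably many, so in a P-space [N y] is
   still open. The [N y] together with the basic sets whose closures miss [Y]
   form a cover in which [N y] is the only member containing [y]. A countable
   subfamily involves countably many [N z] and basic sets; by cofinality some
   [g y], with [y] none of these [z], lists all the corresponding [O z] and
   basic sets, whence [N y] is disjoint from the subfamily and [y] is not in
   its star. *)

(** Copies of [A] and [B] in the sum type [T + U] form a family of two sets, and the one of least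
    cardinality embeds in the other. *)
Lemma card_le_total (T U : Type) (A : set T) (B : set U) :
  A #<= B \/ B #<= A.
Proof.
pose P : set (set (T + U)) := [set @inl T U @` A; @inr T U @` B].
have AE : @inl T U @` A #= A by apply: inj_card_eq => x y _ _ [].
have BE : @inr T U @` B #= B by apply: inj_card_eq => x y _ _ [].
have [|C [PC Cmin]] := @has_min_card_ex _ P.
  by exists (inl @` A); left.
case: PC Cmin => /= -> Cmin; [left|right].
- have := Cmin (inr @` B) (or_intror erefl).
  by rewrite (card_le_eql AE) (card_le_eqr BE).
- have := Cmin (inl @` A) (or_introl erefl).
  by rewrite (card_le_eql BE) (card_le_eqr AE).
Qed.

Lemma cofinal_FinN_countable (T I : Type) (K : set T) (Y : set I)
    (g : I -> nat -> set T) (D : set (nat -> set T)) (S : set T) (C : set I) :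
  infinite_set K -> cofinal_in (@FinN_le T) (FinN K) D -> set_surj Y D g ->
  countable S -> S `<=` K -> countable C ->
  exists y, [/\ Y y, ~ C y, D (g y) & forall s, S s -> exists n, g y n s].
Proof.
move=> Kinf [DK Dcof] gD /countable_injP[e einj] SK /countable_injP[e' e'inj].
(* Diagonalization: [h n] is not contained in [g c n], for the [n]-th [c] of [C]. *)
have /choice[h hP] n : exists k, K k /\
    forall c, C c -> e' c = n -> FinN K (g c) -> ~ g c n k.
  have [[c [Cc cn gc]]|nc] := pselect (exists c,
      [/\ C c, e' c = n & FinN K (g c)]).
    have [k [Kk gk]] := infinite_setN0 (infinite_setD Kinf (gc n).1).
    exists k; split=> // d Cd dn _.
    suff -> : d = c by [].
    by apply: e'inj; rewrite ?inE// dn.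
  have [k Kk] := infinite_setN0 Kinf.
  by exists k; split=> // c Cc cn gc; case: nc; exists c.
(* As [e] is injective on [S], each [f n] is finite, while [f] lists all of [S]; the added [h n]
   prevents any [d] of [D] above [f] from being [g c] with [c] in [C]. *)
pose f n := [set s | S s /\ e s = n] `|` [set h n].
have fK : FinN K f.
  move=> n; split.
    rewrite finite_setU; split=> //.
    have [[s [Ss sn]]|ns] := pselect (exists s, S s /\ e s = n).
      apply: (sub_finite_set _ (finite_set1 s)) => t [St tn].
      by apply: einj; rewrite ?inE// tn.
    rewrite (_ : [set _ | _] = set0)//.
    by apply/seteqP; split=> // s ?; apply: ns; exists s.
  by move=> s [[/SK]|->//]; have [] := hP n.
have [d Dd fd] := Dcof _ fK.
have [y Yy gyd] := gD _ Dd; exists y; split=> // [Cy||s Ss]; last 2 first.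
- by rewrite gyd.
- by exists (e s); rewrite gyd; apply: fd; left.
have [_ /(_ _ Cy erefl)] := hP (e' y); rewrite gyd; apply; first exact: DK.
by apply: fd; right.
Qed.

(** The complement is a countable intersection of open sets. The closures are numbered by an
    injection of [S] into [nat]; a number outside its range contributes the empty set to the
    union. *)
Lemma P_space_closed_bigcup {X : topologicalType} (S : set (set X)) :
  P_space X -> countable S -> closed (\bigcup_(B in S) closure B).
Proof.
move=> PX /countable_injP[e einj]; rewrite -openC; apply: PX.
pose F n := ~` (\bigcup_(B in [set B | S B /\ e B = n]) closure B).
exists F.
  move=> n; rewrite openC.
  have [[B [SB Bn]]|nB] := pselect (exists B, S B /\ e B = n).
    rewrite (_ : \bigcup_(_ in _) _ = closure B); first exact: closed_closure.
    apply/seteqP; split=> [x [A [SA An] Ax]|x Bx]; last by exists B.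
    suff <- : A = B by [].
    by apply: einj; rewrite ?inE// An.
  rewrite (_ : \bigcup_(_ in _) _ = set0); first exact: closed0.
  by apply/seteqP; split=> // x [B ? _]; apply: nB; exists B.
apply/seteqP; split=> [x nx n _ [B [SB _] Bx]|x Fx [B SB Bx]].
  by apply: nx; exists B.
by apply: (Fx (e B) I); exists B.
Qed.

Lemma basis_closure {X : topologicalType} (B : set (set X)) (x : X) (V : set X) :
  regular_space X -> basis B -> nbhs x V ->
  exists U, [/\ B U, U x & closure U `<=` V].
Proof.
move=> rX [_ Bx] /rX[W /Bx[U [BU Ux] UW] WV]; exists U; split=> //.
exact: subset_trans (closureS UW) WV.
Qed.

Theorem theorem4p9 (X : topologicalType) (Y : set X) :
  star_Lindelof X -> regular_space X -> accessible_space X -> P_space X ->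
  infinite_set Y -> closed Y -> discrete_subset Y ->
  card_lt Y (cof_FinN (weight X)).
Proof.
move=> sL rX _ PX Yinf Ycl /discrete_subsetP Yd.
have [bB _] := weight_min X; set B := weight X in bB *.
have [Dcof _] := cof_FinN_min B; set D := cof_FinN B in Dcof *.
suff nDY : ~ (D #<= Y) by split=> //; case: (card_le_total _ _ Y D).
move=> /pcard_surjP[g gD].
have /choice[O OP] y : exists U, Y y ->
    [/\ B U, U y & forall z, Y z -> closure U z -> z = y].
  have [Yy|nYy] := pselect (Y y); last by exists set0.
  have [_ [V Vy VY]] := Yd _ Yy.
  have [U [BU Uy UV]] := basis_closure B y V rX bB Vy.
  exists U => _; split=> // z Yz /UV Vz.
  by have : (V `&` Y) z by []; rewrite VY.
have Binf : infinite_set B.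
  (* [O y] determines [y], the only point of [Y] in its closure, so [B] contains an injective image
     of [Y]. *)
  have Oinj : {in Y &, injective O}.
    move=> y z /set_mem Yy /set_mem Yz Oyz.
    have [_ Oy _] := OP _ Yy; have [_ _] := OP _ Yz; apply=> //.
    by apply: (@subset_closure _ (O z)); rewrite -Oyz.
  move=> Bfin; apply: Yinf; rewrite -(eq_finite_set (inj_card_eq Oinj)).
  apply: sub_finite_set Bfin.
  by move=> _ [y /OP[BO _ _] <-].
(* The guard [D (g y)] is there because [g] may take values outside [D]. *)
pose R y := [set A | [/\ D (g y), exists n, g y n A & ~ closure A y]].
pose N y := O y `\` \bigcup_(A in R y) closure A.
have Rcount y : countable (R y).
  have [Dgy|nDgy] := pselect (D (g y)); last first.
    by rewrite (_ : R y = set0)//; apply/seteqP; split=> // A [].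
  apply: (@sub_countable _ _ _ (\bigcup_n g y n)).
    by apply: subset_card_le => A [_ [n gA] _]; exists n.
  apply: bigcup_countable => // n _; apply: finite_set_countable.
  by have [/(_ _ Dgy)/(_ n)[]] := Dcof.
have Nopen y : Y y -> open (N y).
  move=> /OP[BO _ _]; apply: openI; first exact: bB.1.
  by rewrite openC; apply: P_space_closed_bigcup.
have NP y : Y y -> N y y.
  by move=> /OP[_ Oy _]; split=> // -[A [_ _ nAy] /nAy].
pose small := [set A | B A /\ closure A `&` Y = set0].
pose U := (N @` Y) `|` small.
(* [N z] lies in [O z], whose closure meets [Y] only at [z]; members of [small] miss [Y]. *)
have Uuniq A y : Y y -> U A -> A y -> A = N y.
  move=> Yy [[z Yz <-] [Ozy _]|[_ AY] Ay].
    have [_ _ Oz] := OP _ Yz.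
    by rewrite (Oz y Yy) //; exact: subset_closure.
  by have : (closure A `&` Y) y by [split=> //; exact: subset_closure]; rewrite AY.
have [|V [VU Vcount VX]] := sL U.
  split=> [A [[y /Nopen Ny <-//]|[/bB.1]]//|].
  apply/seteqP; split=> // x _.
  have [Yx|nYx] := pselect (Y x).
    by exists (N x); [left; exists x|exact: NP].
  have [A [BA Ax AY]] : exists A, [/\ B A, A x & closure A `<=` ~` Y].
    apply: basis_closure => //; apply: open_nbhs_nbhs; split=> //.
    by rewrite openC.
  by exists A => //; right; split=> //; apply/disjoints_subset.
(* Choosing a single index for each set of the form [N z] keeps [C] countable; elsewhere the value
   of [c] is arbitrary. *)
have /choice[c cP] A : exists z, (N @` Y) A -> Y z /\ N z = A.
  have [[z Yz <-]|nA] := pselect ((N @` Y) A); first by exists z.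
  by have [z _] := infinite_setN0 Yinf; exists z.
pose C := c @` (V `&` N @` Y).
have Ccount : countable C.
  apply: sub_countable Vcount; apply: card_le_trans (card_image_le _ _) _.
  by apply: subset_card_le => A [].
have [|||y [Yy nCy Dgy Sy]] :=
    @cofinal_FinN_countable _ _ B Y g D ((V `&` small) `|` (O @` C)) C Binf Dcof gD.
- rewrite -bigcup2E; apply: bigcup_countable => // -[|[|n]] _ //=.
  + by apply: sub_countable Vcount; apply: subset_card_le => A [].
  + by apply: sub_countable Ccount; exact: card_image_le.
- move=> A [[_ []]//|[_ [A' [_ /cP[Yc _]] <-] <-]].
  by have [] := OP _ Yc.
- exact: Ccount.
have [A [UA [p [[A' VA' A'p] Ap]]] Ay] : star (\bigcup_(A in V) A) U y.
  by rewrite VX.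
(* Now [A] is [N y], so it suffices to place [p], its common point with [A'], in one of the closures
   removed from [O y]. *)
move: Ap; rewrite (Uuniq _ _ Yy UA Ay) => -[_ nRp]; apply: nRp.
have [A'N|A'small] := VU _ VA'.
  have [Yz Nz] := cP _ A'N; set z := c A' in Yz Nz.
  have Cz : C z by exists A'.
  have [_ _ Oz] := OP _ Yz.
  exists (O z); last by apply: subset_closure; move: A'p; rewrite -Nz => -[].
  split=> //; first by apply: Sy; right; exists z.
  by move=> /(Oz y Yy) yz; apply: nCy; rewrite yz.
exists A'; last exact: subset_closure.
split=> //; first by apply: Sy; left.
move=> clA'y; have [_ A'Y] := A'small.
by have : (closure A' `&` Y) y by []; rewrite A'Y.
Qed.
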